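(* The set $\mathcal{B}_{1,2,4}$ consisting of the identities (M1) $(xy)(zt)=(xz)(yt)$, (M2) $(xy)(zt)=(ty)(zx)$, (M3) $((xy)z)t=((xt)z)y$, (M4) $(x(yz))t=(x(tz))y$, (M5) $x((yz)t)=z((yx)t)$, (M6) $x(y(zt))=z(y(xt))$, and $x(x(yz))=(x(zy))x$ is an independent basis for $\Sigma_{1,2,4}$.
   Context: $\Sigma_{1,2,4}$ is the set of groupoid identities satisfied in the integers $\mathbb{Z}$ by each of the binary operations $x+y$, $x-y$ and $-x-y$. A basis is a set of identities whose equational consequences are exactly $\Sigma_{1,2,4}$; it is independent if no member is a consequence of the others. *)

(* Defs.v *)
From Stdlib Require Import ZArith List.
Import ListNotations.

Inductive term : Type :=
| Var : nat -> term
| Op : term -> term -> term.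

Definition identity := (term * term)%type.

Fixpoint eval {A : Type} (op : A -> A -> A) (v : nat -> A) (s : term) : A :=
  match s with
  | Var n => v n
  | Op s1 s2 => op (eval op v s1) (eval op v s2)
  end.

Definition satisfies (A : Type) (op : A -> A -> A) (e : identity) : Prop :=
  forall v : nat -> A, eval op v (fst e) = eval op v (snd e).

Definition consequence (G : identity -> Prop) (e : identity) : Prop :=
  forall (A : Type) (op : A -> A -> A),
    (forall e', G e' -> satisfies A op e') -> satisfies A op e.

Definition Sigma124 (e : identity) : Prop :=
  satisfies Z Z.add e /\
  satisfies Z Z.sub e /\
  satisfies Z (fun a b => (- a - b)%Z) e.

Definition is_basis (G : identity -> Prop) (S : identity -> Prop) : Prop :=
  forall e, consequence G e <-> S e.

Definition independent (B : list identity) : Prop :=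
  forall i, i < length B ->
    ~ consequence
        (fun e => exists j, j < length B /\ j <> i /\ nth j B (Var 0, Var 0) = e)
        (nth i B (Var 0, Var 0)).

Definition vx := Var 0.
Definition vy := Var 1.
Definition vz := Var 2.
Definition vt := Var 3.

Definition B124 : list identity :=
  [ (* M1 *) (Op (Op vx vy) (Op vz vt), Op (Op vx vz) (Op vy vt));
    (* M2 *) (Op (Op vx vy) (Op vz vt), Op (Op vt vy) (Op vz vx));
    (* M3 *) (Op (Op (Op vx vy) vz) vt, Op (Op (Op vx vt) vz) vy);
    (* M4 *) (Op (Op vx (Op vy vz)) vt, Op (Op vx (Op vt vz)) vy);
    (* M5 *) (Op vx (Op (Op vy vz) vt), Op vz (Op (Op vy vx) vt));
    (* M6 *) (Op vx (Op vy (Op vz vt)), Op vz (Op vy (Op vx vt)));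
    (* 7  *) (Op vx (Op vx (Op vy vz)), Op (Op vx (Op vz vy)) vx) ].

(* Main.v *)
(* The type of a node of a term is the pair of parities of the numbers of left and right edges above it. An identity lies in [Sigma124] iff for every variable [x] there is an integer [k x] such that the left-hand side has [k x] more leaves [x] of each of the types L, LR, and [k x] fewer of each of the types 0, R, than the right-hand side.

   From M1-M6 any two disjoint subtrees of equal type can be exchanged (induction on their distance in the tree). Since the typed leaves determine the number of internal nodes of each type, exchanges can then be used to copy one term from the root downwards into another one with the same typed leaves, so that these two terms are equal.

   The last identity trades x at L, LR for x at 0, R in a term x(x(yz)). If the two sides still differ, comparing the numbers of internal nodes shows that one of the two terms has the same typed leaves as a term x(x(yz)) or (x(zy))x to which the identity applies and brings both sides closer.

   Independence: every identity relates products of exactly four variables, so it is tested in nilpotent groupoids where all products of five elements vanish. *)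
Require Import Defs.
From Stdlib Require Import ZArith List Lia Permutation Bool.
Import ListNotations.

(** * Types of nodes, the laws M1-M6, and contexts *)

Definition ty := (bool * bool)%type.
Definition goL (s : ty) : ty := (negb (fst s), snd s).
Definition goR (s : ty) : ty := (fst s, negb (snd s)).
Definition root : ty := (false, false).

(** M1-M6 are all the exchanges of two leaves of equal type in products of four variables: two for
    the bracketing [(xy)(zt)], one for each of the other four. *)
Record swapping {A : Type} (op : A -> A -> A) : Prop := {
  swap_1 : forall x y z t, op (op x y) (op z t) = op (op x z) (op y t);
  swap_2 : forall x y z t, op (op x y) (op z t) = op (op t y) (op z x);
  swap_3 : forall x y z t, op (op (op x y) z) t = op (op (op x t) z) y;
  swap_4 : forall x y z t, op (op x (op y z)) t = op (op x (op t z)) y;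
  swap_5 : forall x y z t, op x (op (op y z) t) = op z (op (op y x) t);
  swap_6 : forall x y z t, op x (op y (op z t)) = op z (op y (op x t)) }.

(* In a step [(d, x)] of a context, [d] tells whether the hole is on the right, and [x] is the sibling of the hole. *)
Fixpoint plug {A : Type} (op : A -> A -> A) (K : list (bool * A)) (a : A) : A :=
  match K with
  | [] => a
  | (false, x) :: K => op (plug op K a) x
  | (true, x) :: K => op x (plug op K a)
  end.

Fixpoint hole_ty {A : Type} (K : list (bool * A)) (s : ty) : ty :=
  match K with
  | [] => s
  | (false, _) :: K => hole_ty K (goL s)
  | (true, _) :: K => hole_ty K (goR s)
  end.

(** * Exchanging subtrees of equal type *)

Definition dual {A : Type} (op : A -> A -> A) (a b : A) : A := op b a.
Definition mirror {A : Type} (K : list (bool * A)) : list (bool * A) :=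
  map (fun p => (negb (fst p), snd p)) K.

(** Reversing all products fixes M1 and M2 and interchanges M3 with M6 and M4 with M5. *)
Lemma swapping_dual A (op : A -> A -> A) : swapping op -> swapping (dual op).
Proof.
  intros [h1 h2 h3 h4 h5 h6]; split; unfold dual; intros; auto.
Qed.

Lemma plug_mirror A (op : A -> A -> A) K a : plug (dual op) (mirror K) a = plug op K a.
Proof.
  induction K as [|[[] x] K IH]; simpl; rewrite ?IH; reflexivity.
Qed.

Lemma hole_ty_mirror A (K : list (bool * A)) s1 s2 :
  hole_ty (mirror K) (s1, s2) = (snd (hole_ty K (s2, s1)), fst (hole_ty K (s2, s1))).
Proof.
  revert s1 s2; induction K as [|[[] x] K IH]; intros s1 s2; simpl; [reflexivity| |];
    unfold goL, goR; simpl; apply IH.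
Qed.

(** The outer product, of type [s], is the lowest common ancestor of [P] and [Q]. [op] is quantified
    inside so that an induction hypothesis also serves [dual op]. *)
Definition swaps_upto (A : Type) (n : nat) : Prop :=
  forall op : A -> A -> A, swapping op -> forall s K1 K2 P Q,
    length K1 + length K2 <= n ->
    hole_ty K1 (goL s) = hole_ty K2 (goR s) ->
    op (plug op K1 P) (plug op K2 Q) = op (plug op K1 Q) (plug op K2 P).

Ltac by_types H := exfalso; revert H; clear; intros H;
  repeat match goal with s : ty |- _ => destruct s as [[] []] end; discriminate H.
Ltac same_types H := revert H; clear; intros H;
  repeat match goal with s : ty |- _ => destruct s as [[] []] end; exact H.

Ltac both_sides h := etransitivity; [apply h | etransitivity; [|symmetry; apply h]].

(* One of the two subtrees is moved next to an ancestor of the other one by a single law, so that their lowest common ancestor gets closer to both. *)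
Lemma swaps_step A n (IH : swaps_upto A n) (op : A -> A -> A) (Hop : swapping op) s K1 K2 P Q :
  length K1 + length K2 <= S n -> 2 <= length K1 -> 1 <= length K2 ->
  hole_ty K1 (goL s) = hole_ty K2 (goR s) ->
  op (plug op K1 P) (plug op K2 Q) = op (plug op K1 Q) (plug op K2 P).
Proof.
  destruct K1 as [|[a x] [|[b y] K1]]; simpl; try lia.
  destruct K2 as [|[c z] K2]; simpl; try lia.
  intros Hn _ _ H. pose proof Hop as [h1 h2 h3 h4 h5 h6].
  (* If both paths continue in the same direction, M1 makes the subterms containing [P] and [Q]
     siblings. Otherwise the second edge [b] of the longer path decides which laws apply. *)
  destruct a, c.
  - both_sides h1. f_equal.
    apply (IH op Hop (goR s) ((b, y) :: K1) K2); [simpl; lia|].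
    destruct b; same_types H.
  - destruct b.
    + both_sides h4. do 2 f_equal.
      apply (IH op Hop (goR (goL s)) ((false, z) :: K2) K1); [simpl; lia|].
      symmetry; same_types H.
    + both_sides h1. both_sides h5. do 2 f_equal.
      apply (IH op Hop (goL (goR s)) K1 ((true, x) :: K2)); [simpl; lia|].
      same_types H.
  - destruct b.
    + both_sides h2. both_sides h6. do 2 f_equal.
      apply (IH op Hop (goR (goR s)) ((false, x) :: K2) K1); [simpl; lia|].
      symmetry; same_types H.
    + both_sides h3. do 2 f_equal.
      apply (IH op Hop (goL (goL s)) K1 ((true, z) :: K2)); [simpl; lia|].
      same_types H.
  - both_sides h1. f_equal.
    apply (IH op Hop (goL s) ((b, y) :: K1) K2); [simpl; lia|].
    destruct b; same_types H.
Qed.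

Lemma swaps_leaf A n (IH : swaps_upto A n) (op : A -> A -> A) (Hop : swapping op) s K1 P Q :
  length K1 <= S n -> hole_ty K1 (goL s) = goR s ->
  op (plug op K1 P) Q = op (plug op K1 Q) P.
Proof.
  destruct K1 as [|[a x] [|[b y] K1]]; simpl; intros Hn H.
  - by_types H.
  - destruct a; by_types H.
  - pose proof Hop as [h1 h2 h3 h4 h5 h6].
    destruct a, b.
    + both_sides h4. do 2 f_equal.
      apply (IH op Hop (goR (goL s)) [] K1); [simpl; lia|].
      symmetry; same_types H.
    + destruct K1 as [|[c w] K1]; [apply h4|].
      (* The total depth does not drop here: the new contexts have length 2 and that of the rest.
         Both are now long enough for [swaps_step], which allows the bound [S n]. *)
      both_sides h4.
      apply (swaps_step A n IH op Hop s [(true, x); (false, y)] ((c, w) :: K1));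
        [simpl in *; lia | simpl; lia | simpl; lia | symmetry; destruct c; same_types H].
    + destruct K1 as [|[c w] K1]; [apply h3|].
      both_sides h3.
      apply (swaps_step A n IH op Hop s [(false, x); (true, y)] ((c, w) :: K1));
        [simpl in *; lia | simpl; lia | simpl; lia | symmetry; destruct c; same_types H].
    + both_sides h3. do 2 f_equal.
      apply (IH op Hop (goL (goL s)) K1 []); [simpl; lia|].
      same_types H.
Qed.

(** Reversal interchanges the two paths, which reduces the cases with a short [K1] to those with a
    short [K2]. *)
Lemma swaps_dual A (op : A -> A -> A) s K1 K2 P Q :
  (forall s', hole_ty (mirror K2) (goL s') = hole_ty (mirror K1) (goR s') ->
   dual op (plug (dual op) (mirror K2) Q) (plug (dual op) (mirror K1) P) =
   dual op (plug (dual op) (mirror K2) P) (plug (dual op) (mirror K1) Q)) ->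
  hole_ty K1 (goL s) = hole_ty K2 (goR s) ->
  op (plug op K1 P) (plug op K2 Q) = op (plug op K1 Q) (plug op K2 P).
Proof.
  intros H E. specialize (H (snd s, fst s)).
  rewrite !plug_mirror in H. apply H.
  destruct s as [l r]; unfold goL, goR in *; simpl in *.
  rewrite !hole_ty_mirror, E. reflexivity.
Qed.

Lemma swaps_all A n : swaps_upto A n.
Proof.
  induction n as [|n IH]; intros op Hop s K1 K2 P Q Hn H.
  - destruct K1, K2; simpl in Hn; try lia. simpl in H. by_types H.
  - destruct K2 as [|e2 K2]; [apply (swaps_leaf A n IH op Hop s); simpl in *; [lia|exact H]|].
    destruct K1 as [|e1 [|e1' K1]].
    + revert H; apply swaps_dual. intros s' H.
      apply (swaps_leaf A n IH (dual op) (swapping_dual _ _ Hop) s'); [|exact H].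
      unfold mirror; rewrite length_map; simpl in *; lia.
    + destruct K2 as [|e2' K2].
      * destruct Hop as [h1 h2 h3 h4 h5 h6].
        destruct e1 as [[] x], e2 as [[] y]; simpl in *;
          [by_types H | apply h1 | apply h2 | by_types H].
      * revert H; apply swaps_dual. intros s' H.
        apply (swaps_step A n IH (dual op) (swapping_dual _ _ Hop) s'); [| | |exact H];
          unfold mirror; rewrite ?length_map; simpl in *; lia.
    + apply (swaps_step A n IH op Hop s); simpl in *; try lia; exact H.
Qed.

Lemma swap_law A (op : A -> A -> A) (Hop : swapping op) s K1 K2 P Q :
  hole_ty K1 (goL s) = hole_ty K2 (goR s) ->
  op (plug op K1 P) (plug op K2 Q) = op (plug op K1 Q) (plug op K2 P).
Proof. exact (swaps_all A _ op Hop s K1 K2 P Q (le_n _)). Qed.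

(** * Terms with the same typed leaves *)

(** Forks are listed too, with label [None]: copying a term from the root downwards requires finding
    a leaf or a fork of a given type. *)
Fixpoint nodes (s : ty) (t : term) : list (ty * option nat) :=
  match t with
  | Var x => [(s, Some x)]
  | Op a b => (s, None) :: nodes (goL s) a ++ nodes (goR s) b
  end.

Definition label (t : term) : option nat :=
  match t with Var x => Some x | Op _ _ => None end.

Definition forest_nodes (F : list (ty * term)) : list (ty * option nat) :=
  flat_map (fun p => nodes (fst p) (snd p)) F.

Lemma nodes_plug s K : exists R, forall t,
  Permutation (nodes s (plug Op K t)) (nodes (hole_ty K s) t ++ R).
Proof.
  revert s; induction K as [|[[] x] K IH]; intros s; simpl.
  - exists []. intros t. rewrite app_nil_r. reflexivity.
  - destruct (IH (goR s)) as [R H].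
    exists ((s, None) :: nodes (goL s) x ++ R). intros t. rewrite H.
    rewrite Permutation_app_swap_app. apply Permutation_middle.
  - destruct (IH (goL s)) as [R H].
    exists ((s, None) :: R ++ nodes (goR s) x). intros t. rewrite H, <- app_assoc.
    apply Permutation_middle.
Qed.

Lemma nodes_find s t r l : In (r, l) (nodes s t) ->
  exists K u, t = plug Op K u /\ label u = l /\ hole_ty K s = r.
Proof.
  revert s; induction t as [x|a IHa b IHb]; intros s; simpl; intros [E|H].
  - injection E as <- <-. exists [], (Var x); auto.
  - contradiction.
  - injection E as <- <-. exists [], (Op a b); auto.
  - apply in_app_or in H as [H|H].
    + destruct (IHa _ H) as (K & u & -> & Hl & Hr). exists ((false, b) :: K), u; auto.
    + destruct (IHb _ H) as (K & u & -> & Hl & Hr). exists ((true, a) :: K), u; auto.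
Qed.

Lemma forest_find F r l : In (r, l) (forest_nodes F) ->
  exists F1 s K u F2,
    F = F1 ++ (s, plug Op K u) :: F2 /\ label u = l /\ hole_ty K s = r.
Proof.
  intros H. apply in_flat_map in H as ([s t] & HF & H).
  destruct (nodes_find _ _ _ _ H) as (K & u & Ht & Hl & Hr). simpl in Ht; subst t.
  destruct (in_split _ _ HF) as (F1 & F2 & ->).
  exists F1, s, K, u, F2; auto.
Qed.

Lemma forest_nodes_swap F1 F2 s K t u :
  Permutation (forest_nodes ((hole_ty K s, t) :: F1 ++ (s, plug Op K u) :: F2))
              (forest_nodes ((hole_ty K s, u) :: F1 ++ (s, plug Op K t) :: F2)).
Proof.
  unfold forest_nodes; simpl; rewrite !flat_map_app; simpl.
  destruct (nodes_plug s K) as [R H]. rewrite !H, <- !app_assoc.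
  rewrite (Permutation_app_swap_app (flat_map _ F1) (nodes _ u)).
  rewrite (Permutation_app_swap_app (flat_map _ F1) (nodes _ t)).
  apply Permutation_app_swap_app.
Qed.

(* [g] stands for a term with one hole of each of the types [T]; the condition is the swap law for subtrees plugged into two different holes. *)
Definition swap_inv {A : Type} (op : A -> A -> A) (T : list ty) (g : list A -> A) : Prop :=
  forall T1 s1 T2 s2 T3 l1 l2 l3 K1 K2 P Q,
    T = T1 ++ s1 :: T2 ++ s2 :: T3 -> length l1 = length T1 -> length l2 = length T2 ->
    hole_ty K1 s1 = hole_ty K2 s2 ->
    g (l1 ++ plug op K1 P :: l2 ++ plug op K2 Q :: l3) =
    g (l1 ++ plug op K1 Q :: l2 ++ plug op K2 P :: l3).

(** Adapts [g] to a forest whose first tree has been split into its two subtrees. The last branch is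
    a dummy for short lists. *)
Definition split_head {A : Type} (op : A -> A -> A) (g : list A -> A) (l : list A) : A :=
  match l with a :: b :: l => g (op a b :: l) | _ => g l end.

Lemma swap_inv_tail A (op : A -> A -> A) s T g a :
  swap_inv op (s :: T) g -> swap_inv op T (fun l => g (a :: l)).
Proof.
  intros H T1 s1 T2 s2 T3 l1 l2 l3 K1 K2 P Q -> E1 E2 E.
  apply (H (s :: T1) s1 T2 s2 T3 (a :: l1)); simpl; auto.
Qed.

(** For the two new holes this is the swap law at their parent; a swap of one new hole with an old
    one is a swap in [g] with a context longer by one edge. *)
Lemma swap_inv_split A (op : A -> A -> A) (Hop : swapping op) s T g :
  swap_inv op (s :: T) g -> swap_inv op (goL s :: goR s :: T) (split_head op g).
Proof.
  intros H T1 s1 T2 s2 T3 l1 l2 l3 K1 K2 P Q ET E1 E2 E.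
  destruct T1 as [|r1 [|r2 T1]]; simpl in ET.
  - destruct l1; [|discriminate]. injection ET as <- ET.
    destruct T2 as [|r2 T2]; simpl in ET; injection ET as <- ->.
    + destruct l2; [|discriminate]. simpl. f_equal. f_equal.
      apply (swap_law A op Hop s); exact E.
    + destruct l2 as [|b l2]; [discriminate|]. simpl.
      apply (H [] s T2 s2 T3 [] l2 l3 ((false, b) :: K1) K2); auto.
  - destruct l1 as [|a [|]]; try discriminate. injection ET as <- <- ->. simpl.
    apply (H [] s T2 s2 T3 [] l2 l3 ((true, a) :: K1) K2); auto.
  - destruct l1 as [|a [|b l1]]; try discriminate. injection ET as <- <- ->. simpl.
    apply (H (s :: T1) s1 T2 s2 T3 (op a b :: l1)); simpl in *; auto.
Qed.

Lemma eval_plug A (op : A -> A -> A) v K t :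
  eval op v (plug Op K t) = plug op (map (fun p => (fst p, eval op v (snd p))) K) (eval op v t).
Proof. induction K as [|[[] x] K IH]; simpl; rewrite ?IH; reflexivity. Qed.

Lemma hole_ty_map A B (f : A -> B) K s :
  hole_ty (map (fun p => (fst p, f (snd p))) K) s = hole_ty K s.
Proof. revert s; induction K as [|[[] x] K IH]; intros s; simpl; auto. Qed.

Definition forest_eval {A : Type} (op : A -> A -> A) v (F : list (ty * term)) : list A :=
  map (fun p => eval op v (snd p)) F.

(** [g] is the part already copied; [F] and [G] are what still fills its holes on the two sides. *)
Definition forest_determined {A : Type} (op : A -> A -> A) v F G : Prop :=
  forall g, map fst F = map fst G -> Permutation (forest_nodes F) (forest_nodes G) ->
    swap_inv op (map fst F) g -> g (forest_eval op v F) = g (forest_eval op v G).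

Definition forest_determined_upto {A : Type} (op : A -> A -> A) v n : Prop :=
  forall F G, length (forest_nodes F) <= n -> forest_determined op v F G.

Lemma forest_eval_swap A (op : A -> A -> A) v F1 F2 s K t u g :
  swap_inv op (map fst ((hole_ty K s, t) :: F1 ++ (s, plug Op K u) :: F2)) g ->
  g (forest_eval op v ((hole_ty K s, t) :: F1 ++ (s, plug Op K u) :: F2)) =
  g (forest_eval op v ((hole_ty K s, u) :: F1 ++ (s, plug Op K t) :: F2)).
Proof.
  intros H. unfold forest_eval; simpl; rewrite !map_app; simpl; rewrite !eval_plug.
  apply (H [] (hole_ty K s) (map fst F1) s (map fst F2) []
    (map (fun p => eval op v (snd p)) F1) _ []).
  - simpl. rewrite map_app. reflexivity.
  - reflexivity.
  - rewrite !length_map. reflexivity.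
  - simpl. rewrite hole_ty_map. reflexivity.
Qed.

(** Matching roots use up one node: a leaf is absorbed into [g], a fork is replaced by its two
    subtrees. *)
Lemma forest_same_label A (op : A -> A -> A) (Hop : swapping op) v n s t u F G :
  forest_determined_upto op v n ->
  length (forest_nodes ((s, t) :: F)) <= S n -> label t = label u ->
  forest_determined op v ((s, t) :: F) ((s, u) :: G).
Proof.
  intros IH Hn El g ET HP Hg.
  destruct t as [x|a b], u as [y|c d]; try discriminate El.
  - injection El as <-. simpl in *. apply Permutation_cons_inv in HP.
    injection ET as ET.
    apply (IH F G ltac:(lia) (fun l => g (eval op v (Var x) :: l))); auto.
    eapply swap_inv_tail; exact Hg.
  - simpl in *. apply Permutation_cons_inv in HP. injection ET as ET.
    rewrite <- !app_assoc in *.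
    apply (IH ((goL s, a) :: (goR s, b) :: F) ((goL s, c) :: (goR s, d) :: G)
      ltac:(simpl; lia) (split_head op g)); auto.
    + simpl. congruence.
    + apply swap_inv_split; auto.
Qed.

(** As the first tree is a mere leaf, the node wanted in its place lies in another tree, and the two
    disjoint subtrees can be exchanged. *)
Lemma forest_head_swap A (op : A -> A -> A) v s x F l :
  l <> Some x -> In (s, l) (forest_nodes ((s, Var x) :: F)) ->
  exists u G, label u = l /\ map fst G = map fst F /\
    Permutation (forest_nodes ((s, Var x) :: F)) (forest_nodes ((s, u) :: G)) /\
    forall g, swap_inv op (map fst ((s, Var x) :: F)) g ->
      g (forest_eval op v ((s, Var x) :: F)) = g (forest_eval op v ((s, u) :: G)).
Proof.
  intros Hl [E|H]; [congruence|].
  destruct (forest_find _ _ _ H) as (F1 & r & K & u & F2 & -> & Hu & <-).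
  exists u, (F1 ++ (r, plug Op K (Var x)) :: F2). repeat split; auto.
  - rewrite !map_app; reflexivity.
  - apply forest_nodes_swap.
  - apply forest_eval_swap.
Qed.

Lemma nodes_label_in s t : In (s, label t) (nodes s t).
Proof. destruct t; simpl; auto. Qed.

Lemma forest_determined_all A (op : A -> A -> A) (Hop : swapping op) v n :
  forest_determined_upto op v n.
Proof.
  induction n as [|n IH]; intros F G Hn g ET HP Hg.
  - destruct F as [|[s []] F]; simpl in Hn; try lia.
    destruct G; [reflexivity|discriminate].
  - destruct F as [|[s t] F], G as [|[r u] G]; try discriminate; [reflexivity|].
    injection ET as <- ET.
    assert (D : {label t = label u} + {label t <> label u}) by (repeat decide equality).
    destruct D as [El|El].
    { apply (forest_same_label A op Hop v n); auto. simpl; congruence. }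
    assert (Ht : In (s, label t) (forest_nodes ((s, u) :: G))).
    { apply (Permutation_in _ HP), in_or_app. left; apply nodes_label_in. }
    assert (Hu : In (s, label u) (forest_nodes ((s, t) :: F))).
    { apply (Permutation_in _ (Permutation_sym HP)), in_or_app. left; apply nodes_label_in. }
    (* The labels differ, so at least one root is a leaf; the exchange is made in its forest. *)
    destruct u as [y|c d].
    + destruct (forest_head_swap A op v _ _ _ _ El Ht) as (u & G' & Eu & E' & HP' & Hv).
      rewrite Hv by (simpl in *; rewrite <- ET; exact Hg).
      apply (forest_same_label A op Hop v n); auto.
      * simpl; congruence.
      * rewrite <- HP'; exact HP.
    + destruct t as [x|a b]; [|contradiction El; reflexivity].
      assert (El' : label (Op c d) <> Some x) by discriminate.
      destruct (forest_head_swap A op v _ _ _ _ El' Hu) as (t & F' & Et & E' & HP' & Hv).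
      rewrite Hv by exact Hg.
      apply (forest_same_label A op Hop v n); auto.
      * rewrite <- HP'; exact Hn.
      * simpl; congruence.
      * rewrite <- HP'; exact HP.
      * simpl in *; rewrite E'; exact Hg.
Qed.

Fixpoint leaves (s : ty) (t : term) : list (ty * nat) :=
  match t with
  | Var x => [(s, x)]
  | Op a b => leaves (goL s) a ++ leaves (goR s) b
  end.

Fixpoint forks (s : ty) (t : term) : list ty :=
  match t with
  | Var _ => []
  | Op a b => s :: forks (goL s) a ++ forks (goR s) b
  end.

Lemma nodes_leaves_forks s t :
  Permutation (nodes s t)
    (map (fun p => (fst p, Some (snd p))) (leaves s t) ++ map (fun r => (r, None)) (forks s t)).
Proof.
  revert s; induction t as [x|a IHa b IHb]; intros s; simpl; [reflexivity|].
  rewrite IHa, IHb, !map_app, <- Permutation_middle, <- !app_assoc.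
  apply perm_skip, Permutation_app_head, Permutation_app_swap_app.
Qed.

Definition ty_dec (s r : ty) : {s = r} + {s <> r}.
Proof. repeat decide equality. Defined.

Definition count (s : ty) (l : list ty) : nat := count_occ ty_dec l s.

(** Both sides count the nodes of type [r]: leaves and forks on the left; the root and the children
    of forks on the right, [goL] and [goR] being involutions. *)
Definition balanced (s : ty) (L : list (ty * nat)) (I : ty -> nat) : Prop :=
  forall r, count r (map fst L) + I r = count r [s] + I (goL r) + I (goR r).

Lemma count_app r l1 l2 : count r (l1 ++ l2) = count r l1 + count r l2.
Proof. apply count_occ_app. Qed.

Lemma count_cons r s l : count r (s :: l) = count r [s] + count r l.
Proof. exact (count_app r [s] l). Qed.

Lemma balance s t : balanced s (leaves s t) (fun r => count r (forks s t)).
Proof.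
  unfold balanced; revert s; induction t as [x|a IHa b IHb]; intros s r.
  - simpl. lia.
  - specialize (IHa (goL s) r); specialize (IHb (goR s) r).
    simpl leaves; simpl forks.
    rewrite map_app, !(count_cons _ s (_ ++ _)), !count_app.
    assert (E : forall q, count (goL q) [s] = count q [goL s] /\ count (goR q) [s] = count q [goR s]).
    { intros q. destruct s as [[] []], q as [[] []]; split; reflexivity. }
    destruct (E r) as [-> ->]. lia.
Qed.

Lemma count_perm l1 l2 : Permutation l1 l2 -> forall r, count r l1 = count r l2.
Proof. intros H. apply Permutation_count_occ, H. Qed.

(** The balance equations are a nonsingular linear system for the four fork counts (eigenvalues -1,
    1, 1, 3 up to sign), so equal leaves give equal nodes. *)
Lemma leaves_determine A (op : A -> A -> A) (Hop : swapping op) v t u :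
  Permutation (leaves root t) (leaves root u) -> eval op v t = eval op v u.
Proof.
  intros HP.
  assert (HF : Permutation (forks root t) (forks root u)).
  { apply (Permutation_count_occ ty_dec). intros r.
    fold (count r (forks root t)) (count r (forks root u)).
    pose proof (balance root t) as Ht. pose proof (balance root u) as Hu.
    pose proof (count_perm _ _ (Permutation_map fst HP)) as E.
    unfold balanced in Ht, Hu.
    assert (G : forall q, In q [(false, false); (false, true); (true, false); (true, true)] ->
      count q (forks root t) = count q (forks root u)).
    { pose proof (Ht (false, false)); pose proof (Ht (false, true));
      pose proof (Ht (true, false)); pose proof (Ht (true, true));
      pose proof (Hu (false, false)); pose proof (Hu (false, true));
      pose proof (Hu (true, false)); pose proof (Hu (true, true)).
      rewrite !E in *. unfold goL, goR in *; simpl fst in *; simpl snd in *; simpl negb in *.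
      intros q [<-|[<-|[<-|[<-|[]]]]]; lia. }
    apply G. destruct r as [[] []]; simpl; auto. }
  apply (forest_determined_all A op Hop v _ [(root, t)] [(root, u)] (le_n _)
    (fun l => hd (eval op v t) l)); [reflexivity| |].
  - simpl. rewrite !app_nil_r, !nodes_leaves_forks, HP, HF. reflexivity.
  (* Vacuous: there is only one hole. *)
  - intros T1 s1 T2 s2 T3 l1 l2 l3 K1 K2 P Q E.
    apply (f_equal (@length _)) in E. simpl in E. rewrite length_app in E.
    simpl in E. rewrite length_app in E. simpl in E. lia.
Qed.

(** * Terms with prescribed typed leaves *)

Definition tally (r : ty) (L : list (ty * nat)) : nat := count r (map fst L).

Lemma tally_cons r s x L : tally r ((s, x) :: L) = count r [s] + tally r L.
Proof. exact (count_cons r s (map fst L)). Qed.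

Lemma tally_perm L L' : Permutation L L' -> forall r, tally r L = tally r L'.
Proof. intros H r. apply count_perm, Permutation_map, H. Qed.

Lemma tally_pick r L : 1 <= tally r L -> exists x R, Permutation L ((r, x) :: R).
Proof.
  intros H. assert (Hin : In r (map fst L)) by (apply (count_occ_In ty_dec); exact H).
  apply in_map_iff in Hin as ([q x] & E & Hin). simpl in E; subst q.
  destruct (in_split _ _ Hin) as (L1 & L2 & ->).
  exists x, (L1 ++ L2). symmetry; apply Permutation_middle.
Qed.

(** Merges two leaves into their parent, removing one fork. The variable 0 of the merged leaf is a
    placeholder, which [graft] later replaces by a product. *)
Lemma balanced_unfork L I s :
  balanced root L I -> 1 <= I s -> 1 <= tally (goL s) L -> 1 <= tally (goR s) L ->
  exists y z R, Permutation L ((goL s, y) :: (goR s, z) :: R) /\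
    balanced root ((s, 0) :: R) (fun r => I r - count r [s]).
Proof.
  intros HB HI HL HR.
  destruct (tally_pick _ _ HL) as (y & R1 & H1).
  assert (HR1 : 1 <= tally (goR s) R1).
  { rewrite (tally_perm _ _ H1), tally_cons in HR. destruct s as [[] []]; exact HR. }
  destruct (tally_pick _ _ HR1) as (z & R & H2). rewrite H2 in H1.
  exists y, z, R. split; [exact H1|].
  intros r. specialize (HB r). fold (tally r L) in HB. fold (tally r ((s, 0) :: R)).
  rewrite (tally_perm _ _ H1), !tally_cons in HB. rewrite tally_cons.
  destruct s as [[] []], r as [[] []]; unfold goL, goR, count in *; simpl in *; lia.
Qed.

Lemma graft s w r m y z : In (r, m) (leaves s w) -> exists w' R,
  Permutation (leaves s w) ((r, m) :: R) /\
  Permutation (leaves s w') ((goL r, y) :: (goR r, z) :: R).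
Proof.
  revert s; induction w as [x|a IHa b IHb]; intros s H; simpl in H.
  - destruct H as [[= <- <-]|[]]. exists (Op (Var y) (Var z)), []. split; reflexivity.
  - apply in_app_or in H as [H|H].
    + destruct (IHa _ H) as (w & R & H1 & H2).
      exists (Op w b), (R ++ leaves (goR s) b). simpl. rewrite H1, H2. split; reflexivity.
    + destruct (IHb _ H) as (w & R & H1 & H2).
      exists (Op a w), (leaves (goL s) a ++ R). simpl. rewrite H1, H2. split.
      * symmetry; apply Permutation_middle.
      * rewrite <- Permutation_middle. apply perm_skip. symmetry; apply Permutation_middle.
Qed.

Definition total (I : ty -> nat) : nat :=
  I (false, false) + I (false, true) + I (true, false) + I (true, true).

Ltac four_types H :=
  pose proof (H (false, false)); pose proof (H (false, true));
  pose proof (H (true, false)); pose proof (H (true, true)).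

(* [L] determines the numbers [I] of forks of each type. Some fork can always be chosen to be the last one; merging its two leaves keeps the balance. *)
Lemma realize n : forall L I, total I = n -> (I root = 0 -> n = 0) -> balanced root L I ->
  exists w, Permutation (leaves root w) L.
Proof.
  induction n as [|n IH]; intros L I Hn H0 HB.
  - assert (HL : forall r, tally r L = count r [root]).
    { four_types HB. unfold total, balanced, goL, goR in *. intros [[] []]; unfold tally; simpl in *; lia. }
    destruct (tally_pick root L) as (x & R & H).
    { rewrite HL. reflexivity. }
    exists (Var x). rewrite H. simpl. apply perm_skip.
    enough (E : map fst R = []) by (destruct R; [reflexivity|discriminate]).
    apply (count_occ_inv_nil ty_dec). intros r.
    specialize (HL r). rewrite (tally_perm _ _ H), tally_cons in HL.
    unfold tally, count in *. lia.
  - assert (Hs : exists s, 1 <= I s /\ (I s - count s [root] = 0 -> s = root -> n = 0) /\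
      1 <= tally (goL s) L /\ 1 <= tally (goR s) L).
    { four_types HB. unfold total, goL, goR, tally, root in *.
      change (count (false, false) [(false, false)]) with 1 in *.
      change (count (false, true) [(false, false)]) with 0 in *.
      change (count (true, false) [(false, false)]) with 0 in *.
      change (count (true, true) [(false, false)]) with 0 in *.
      simpl fst in *; simpl snd in *; simpl negb in *.
      (* Forks of types 0 and LR have children of types L and R; forks of types L and R have
         children of types 0 and LR. The last fork of type 0 may go only if no other fork
         remains. *)
      assert (C : (1 <= I (true, true) \/ 2 <= I (false, false) \/ n = 0) /\
        1 <= count (true, false) (map fst L) /\ 1 <= count (false, true) (map fst L) \/
        (1 <= I (true, false) \/ 1 <= I (false, true)) /\
        1 <= count (false, false) (map fst L) /\ 1 <= count (true, true) (map fst L)) by lia.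
      destruct C as [([C|[C|C]] & C1 & C2)|([C|C] & C1 & C2)].
      - exists (true, true); repeat split; simpl; auto; discriminate.
      - exists (false, false); repeat split; simpl; auto; try lia.
      - exists (false, false); repeat split; simpl; auto; lia.
      - exists (true, false); repeat split; simpl; auto; discriminate.
      - exists (false, true); repeat split; simpl; auto; discriminate. }
    destruct Hs as (s & HI & Hr & HL & HR).
    destruct (balanced_unfork L I s HB HI HL HR) as (y & z & R & HP & HB').
    destruct (IH ((s, 0) :: R) (fun r => I r - count r [s])) as [w Hw]; auto.
    + unfold total in *; destruct s as [[] []]; unfold count; simpl; lia.
    + intros E. destruct (ty_dec s root) as [->|Hs]; [apply Hr; auto|].
      assert (n = 0 \/ n <> 0) as [|Hn0] by lia; auto.
      assert (count root [s] = 0) by (destruct s as [[] []]; auto; contradiction Hs; reflexivity).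
      assert (I root = 0) by lia. lia.
    + destruct (graft root w s 0 y z) as (w' & R' & H1 & H2).
      { apply (Permutation_in _ (Permutation_sym Hw)); left; reflexivity. }
      rewrite H1 in Hw. apply Permutation_cons_inv in Hw.
      exists w'. rewrite H2, HP, Hw. reflexivity.
Qed.

Definition tl_dec (p q : ty * nat) : {p = q} + {p <> q}.
Proof. repeat decide equality. Defined.

Definition occ (r : ty) (x : nat) (t : term) : nat := count_occ tl_dec (leaves root t) (r, x).

Lemma count_occ_extract2 L r s x : r <> s -> 1 <= count_occ tl_dec L (r, x) -> 1 <= count_occ tl_dec L (s, x) ->
  exists R, Permutation L ((r, x) :: (s, x) :: R).
Proof.
  intros Hrs Hr Hs.
  apply count_occ_In, in_split in Hr as (L1 & L2 & ->).
  assert (H : Permutation (L1 ++ (r, x) :: L2) ((r, x) :: L1 ++ L2))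
    by (symmetry; apply Permutation_middle).
  rewrite (Permutation_count_occ tl_dec) in H. rewrite H in Hs.
  rewrite <- (Permutation_count_occ tl_dec) in H.
  rewrite count_occ_cons_neq in Hs by congruence.
  apply count_occ_In, in_split in Hs as (R1 & R2 & E). rewrite E in H.
  exists (R1 ++ R2). rewrite H. apply perm_skip. symmetry; apply Permutation_middle.
Qed.

Lemma realize_fork L I : 1 <= I root -> balanced root L I ->
  exists y z, Permutation L (leaves root (Op y z)).
Proof.
  intros HI HB. destruct (realize _ L I eq_refl) as [[m|y z] H]; auto.
  - unfold total, root in *; lia.
  - exfalso. simpl in H. apply Permutation_length_1_inv in H; subst L.
    four_types HB. unfold goL, goR, count, root in *; simpl in *. lia.
  - exists y, z. symmetry; exact H.
Qed.

Definition fork_count (r : ty) (t : term) : nat := count r (forks root t).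

(** The equation on [I] is the balance of [R], expressed through that of [t] by subtracting [L]. *)
Lemma realize_remainder t L R I :
  Permutation (leaves root t) (L ++ R) -> 1 <= I root ->
  (forall r, I (goL r) + I (goR r) + fork_count r t + tally r L =
    fork_count (goL r) t + fork_count (goR r) t + I r) ->
  exists y z, Permutation R (leaves root (Op y z)).
Proof.
  intros HP HI H. apply (realize_fork R I HI). intros r.
  specialize (H r). pose proof (balance root t r) as B.
  fold (tally r (leaves root t)) in B. rewrite (tally_perm _ _ HP) in B.
  unfold tally in *. rewrite map_app, count_app in B. unfold fork_count in *. lia.
Qed.

(** * Trading leaves with the last identity *)

Definition twist_law {A : Type} (op : A -> A -> A) : Prop :=
  forall x y z, op x (op x (op y z)) = op (op x (op z y)) x.

(** The inner product has type 0 in [right_form] and LR in [left_form]; reversing it there keeps [y]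
    at L and [z] at R, so only the two [x] change type. *)
Definition right_form (x : nat) (y z : term) : term := Op (Var x) (Op (Var x) (Op y z)).
Definition left_form (x : nat) (y z : term) : term := Op (Op (Var x) (Op z y)) (Var x).

Definition right_types : list ty := [(true, false); (true, true)].
Definition left_types : list ty := [(false, false); (false, true)].
Definition pair_at (T : list ty) (x : nat) : list (ty * nat) := map (fun r => (r, x)) T.

Lemma leaves_right_form x y z :
  Permutation (leaves root (right_form x y z)) (pair_at right_types x ++ leaves root (Op y z)).
Proof. reflexivity. Qed.

Lemma leaves_left_form x y z :
  Permutation (leaves root (left_form x y z)) (pair_at left_types x ++ leaves root (Op y z)).
Proof.
  simpl. apply perm_skip. rewrite <- Permutation_cons_append. apply perm_skip.
  apply Permutation_app_comm.
Qed.

Lemma right_form_exists t R x :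
  Permutation (leaves root t) (pair_at right_types x ++ R) ->
  2 <= fork_count (false, false) t -> 1 <= fork_count (false, true) t ->
  exists y z, Permutation (leaves root t) (leaves root (right_form x y z)).
Proof.
  intros HP H0 H1.
  (* The removed forks are the root and its right child; those of [yz] remain. *)
  destruct (realize_remainder t _ R
    (fun r => fork_count r t - count r [(false, false); (false, true)]) HP) as (y & z & H).
  - change (1 <= fork_count (false, false) t - 1); lia.
  - intros [[] []]; unfold tally, count, goL, goR; simpl; lia.
  - exists y, z. rewrite leaves_right_form, HP, H. reflexivity.
Qed.

Lemma left_form_exists t R x :
  Permutation (leaves root t) (pair_at left_types x ++ R) ->
  1 <= fork_count (false, false) t ->
  1 <= fork_count (true, false) t -> 1 <= fork_count (true, true) t ->
  exists y z, Permutation (leaves root t) (leaves root (left_form x y z)).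
Proof.
  intros HP H0 H1 H2.
  (* The fork of [zy] has type LR, while in [Op y z] it is the root; so the removed types are L and
     LR. *)
  destruct (realize_remainder t _ R
    (fun r => fork_count r t - count r [(true, false); (true, true)]) HP) as (y & z & H).
  - change (1 <= fork_count (false, false) t - 0); lia.
  - intros [[] []]; unfold tally, count, goL, goR; simpl; lia.
  - exists y, z. rewrite leaves_left_form, HP, H. reflexivity.
Qed.

Local Open Scope Z_scope.

(** * Finite sums over variables, and the distance between two terms *)

Fixpoint zsum (M : nat) (f : nat -> Z) : Z :=
  match M with O => 0 | S M => zsum M f + f M end.

Lemma zsum_add M f g : zsum M (fun x => f x + g x) = zsum M f + zsum M g.
Proof. induction M; simpl; lia. Qed.

Lemma zsum_opp M f : zsum M (fun x => - f x) = - zsum M f.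
Proof. induction M; simpl; lia. Qed.

Lemma zsum_ext M f g : (forall x, (x < M)%nat -> f x = g x) -> zsum M f = zsum M g.
Proof.
  induction M as [|M IH]; intros H; simpl; [reflexivity|].
  rewrite IH, H; auto.
Qed.

Lemma zsum_delta M x : (x < M)%nat -> zsum M (fun y => if Nat.eq_dec x y then 1 else 0) = 1.
Proof.
  induction M as [|M IH]; intros H; simpl; [lia|].
  destruct (Nat.eq_dec x M) as [->|].
  - rewrite (zsum_ext M _ (fun _ => 0)).
    + clear. induction M; simpl; lia.
    + intros y Hy. destruct (Nat.eq_dec M y); lia.
  - rewrite IH; lia.
Qed.

Lemma zsum_nonneg_dec M f : 0 <= zsum M f ->
  (exists x, (x < M)%nat /\ 0 < f x) \/ (forall x, (x < M)%nat -> f x = 0).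
Proof.
  assert (G : (exists x, (x < M)%nat /\ 0 < f x) \/
    zsum M f <= 0 /\ (zsum M f = 0 -> forall x, (x < M)%nat -> f x = 0)).
  { induction M as [|M [(x & Hx & H)|[H1 H2]]]; simpl.
    - right; split; [lia|]. intros; lia.
    - left; exists x; split; [lia|exact H].
    - destruct (Z_lt_le_dec 0 (f M)) as [H|H]; [left; exists M; split; [lia|exact H]|].
      right; split; [lia|]. intros E x Hx.
      destruct (Nat.eq_dec x M) as [->|]; [lia|]. apply H2; lia. }
  destruct G as [G|[G1 G2]]; [left; exact G|].
  intros H. right. apply G2. lia.
Qed.

Definition vars_below (M : nat) (t : term) : Prop :=
  Forall (fun p => (snd p < M)%nat) (leaves root t).

Lemma occ_cons L r s x y : count_occ tl_dec ((s, y) :: L) (r, x) =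
  ((if ty_dec s r then if Nat.eq_dec y x then 1 else 0 else 0) + count_occ tl_dec L (r, x))%nat.
Proof.
  cbn [count_occ]. destruct (tl_dec (s, y) (r, x)), (ty_dec s r), (Nat.eq_dec y x);
    (reflexivity || congruence).
Qed.

Lemma tally_zsum M L r : Forall (fun p => (snd p < M)%nat) L ->
  Z.of_nat (tally r L) = zsum M (fun x => Z.of_nat (count_occ tl_dec L (r, x))).
Proof.
  induction 1 as [|[s x] L Hx HL IH].
  - simpl. rewrite (zsum_ext M _ (fun _ => 0 + 0)) by reflexivity.
    rewrite zsum_add. clear. unfold tally; simpl. induction M; simpl; lia.
  - rewrite tally_cons, Nat2Z.inj_add, IH. simpl in Hx.
    destruct (ty_dec s r) as [->|Hs].
    + rewrite (zsum_ext M (fun y => Z.of_nat (count_occ tl_dec ((r, x) :: L) (r, y)))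
        (fun y => (if Nat.eq_dec x y then 1 else 0) + Z.of_nat (count_occ tl_dec L (r, y)))).
      * rewrite zsum_add, zsum_delta by exact Hx.
        unfold count; simpl. destruct (ty_dec r r); [reflexivity|contradiction].
      * intros y _. rewrite occ_cons. destruct (ty_dec r r), (Nat.eq_dec x y); try contradiction; lia.
    + rewrite (zsum_ext M (fun y => Z.of_nat (count_occ tl_dec ((s, x) :: L) (r, y)))
        (fun y => Z.of_nat (count_occ tl_dec L (r, y)))).
      * unfold count; simpl. destruct (ty_dec s r); [contradiction|reflexivity].
      * intros y _. rewrite occ_cons. destruct (ty_dec s r); [contradiction|reflexivity].
Qed.

(* [k x] is the number of times the two occurrences of [x] of types [right_types] have to be traded for occurrences of types [left_types] to turn the leaves of [t] into those of [u]. *)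
Definition differ_by (k : nat -> Z) (t u : term) : Prop :=
  forall r x, Z.of_nat (occ r x t) = Z.of_nat (occ r x u) + (if fst r then k x else - k x).

Lemma differ_by_sym k t u : differ_by k t u -> differ_by (fun x => - k x) u t.
Proof. intros H r x. specialize (H r x). destruct (fst r); lia. Qed.

Definition dec_at (x : nat) (k : nat -> Z) (y : nat) : Z := k y - (if Nat.eq_dec x y then 1 else 0).

Lemma occ_perm t u : Permutation (leaves root t) (leaves root u) -> forall r x, occ r x t = occ r x u.
Proof. intros H r x. unfold occ. apply Permutation_count_occ, H. Qed.

Lemma occ_forms r x v y z :
  Z.of_nat (occ r x (right_form v y z)) - Z.of_nat (occ r x (left_form v y z)) =
  (if Nat.eq_dec v x then if fst r then 1 else -1 else 0).
Proof.
  unfold occ. rewrite (proj1 (Permutation_count_occ tl_dec _ _) (leaves_right_form v y z)).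
  rewrite (proj1 (Permutation_count_occ tl_dec _ _) (leaves_left_form v y z)).
  unfold pair_at; simpl map. rewrite <- !app_comm_cons, !app_nil_l, !occ_cons.
  generalize (count_occ tl_dec (leaves root (Op y z)) (r, x)); intros c.
  rewrite !Nat2Z.inj_add. destruct r as [[] []], (Nat.eq_dec v x); cbn -[Z.of_nat Z.add Z.sub]; lia.
Qed.

Lemma vars_below_perm M t u : Permutation (leaves root t) (leaves root u) ->
  vars_below M t -> vars_below M u.
Proof. intros H. apply Permutation_Forall, H. Qed.

Lemma vars_below_forms M x y z :
  vars_below M (right_form x y z) <-> vars_below M (left_form x y z).
Proof.
  split; intros H;
    [apply (Permutation_Forall (leaves_right_form x y z)) in H;
     apply (Permutation_Forall (Permutation_sym (leaves_left_form x y z)))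
    |apply (Permutation_Forall (leaves_left_form x y z)) in H;
     apply (Permutation_Forall (Permutation_sym (leaves_right_form x y z)))];
    apply Forall_app in H as [H1 H2]; apply Forall_app; split; auto;
    inversion_clear H1; repeat constructor; auto.
Qed.

Lemma zsum_dec_at M x k : (x < M)%nat -> 0 < k x ->
  zsum M (fun y => Z.abs (dec_at x k y)) = zsum M (fun y => Z.abs (k y)) - 1.
Proof.
  intros Hx Hk.
  rewrite (zsum_ext M _ (fun y => Z.abs (k y) + - (if Nat.eq_dec x y then 1 else 0))).
  - rewrite zsum_add, zsum_opp, zsum_delta by exact Hx. lia.
  - intros y _. unfold dec_at. destruct (Nat.eq_dec x y) as [<-|]; lia.
Qed.

Definition equal_upto {A : Type} (op : A -> A -> A) v M n : Prop :=
  forall t u k, vars_below M t -> vars_below M u -> differ_by k t u ->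
    zsum M (fun x => Z.abs (k x)) <= n -> eval op v t = eval op v u.

Lemma tally_differ_by M k t u : vars_below M t -> vars_below M u -> differ_by k t u ->
  forall r, Z.of_nat (tally r (leaves root t)) =
    Z.of_nat (tally r (leaves root u)) + (if fst r then zsum M k else - zsum M k).
Proof.
  intros Ht Hu H r. rewrite !(tally_zsum M) by assumption.
  rewrite (zsum_ext M (fun x => Z.of_nat (count_occ tl_dec (leaves root t) (r, x)))
    (fun x => Z.of_nat (occ r x u) + (if fst r then k x else - k x))) by (intros; apply H).
  rewrite zsum_add. destruct (fst r); rewrite ?zsum_opp; reflexivity.
Qed.

Lemma occ_le_tally r x t : (occ r x t <= tally r (leaves root t))%nat.
Proof.
  unfold occ. induction (leaves root t) as [|[s y] L IH]; [simpl; lia|].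
  rewrite occ_cons, tally_cons. unfold count; simpl.
  destruct (ty_dec s r), (Nat.eq_dec y x); lia.
Qed.

Lemma equal_step A (op : A -> A -> A) (Hop : swapping op) (Htw : twist_law op) v M n t u k :
  equal_upto op v M n -> vars_below M t -> vars_below M u -> differ_by k t u ->
  zsum M (fun x => Z.abs (k x)) <= n + 1 -> 0 <= zsum M k -> eval op v t = eval op v u.
Proof.
  intros IH Ht Hu Hk Hn HK.
  destruct (zsum_nonneg_dec M k HK) as [(x & Hx & Hkx)|H0].
  - pose proof (tally_differ_by M k t u Ht Hu Hk) as HT.
    pose proof (Hk (false, false) x); pose proof (Hk (false, true) x);
    pose proof (Hk (true, false) x); pose proof (Hk (true, true) x).
    cbn [fst] in *.
    (* Let K be the sum of [k]. By balance [t] has K more forks of each of the types 0, R and K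
       fewer of each of L, LR than [u]. If K > 0, the first alternative holds. If K = 0, the fork
       counts agree and leaves of all four types occur, so the two alternatives cannot both fail. *)
    assert (C : (2 <= fork_count (false, false) t)%nat /\ (1 <= fork_count (false, true) t)%nat \/
      (1 <= fork_count (false, false) u)%nat /\
      (1 <= fork_count (true, false) u)%nat /\ (1 <= fork_count (true, true) u)%nat).
    { pose proof (occ_le_tally (false, false) x u); pose proof (occ_le_tally (false, true) x u);
      pose proof (occ_le_tally (true, false) x t); pose proof (occ_le_tally (true, true) x t).
      pose proof (balance root t) as Bt; pose proof (balance root u) as Bu.
      four_types HT. four_types Bt. four_types Bu. clear HT Bt Bu Hk.
      unfold fork_count, tally, goL, goR, root in *. cbn [fst snd negb] in *.
      change (count (false, false) [(false, false)]) with 1%nat in *.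
      change (count (false, true) [(false, false)]) with 0%nat in *.
      change (count (true, false) [(false, false)]) with 0%nat in *.
      change (count (true, true) [(false, false)]) with 0%nat in *.
      destruct u as [w|u1 u2].
      - cbn [leaves forks map fst] in *. unfold count in *. simpl in *. lia.
      - assert (1 <= count (false, false) (forks (false, false) (Op u1 u2)))%nat.
        { unfold count; simpl. lia. }
        lia. }
    destruct C as [[C1 C2]|(C0 & C1 & C2)].
    + destruct (count_occ_extract2 (leaves root t) (true, false) (true, true) x) as [R HR]; [discriminate|unfold occ in *; lia|unfold occ in *; lia|].
      destruct (right_form_exists t R x HR C1 C2) as (y & z & HP).
      rewrite (leaves_determine A op Hop v _ _ HP).
      transitivity (eval op v (left_form x y z)); [apply Htw|].
      apply (IH _ _ (dec_at x k)); auto.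
      * apply vars_below_forms. apply (vars_below_perm M _ _ HP Ht).
      * intros r w. specialize (Hk r w). rewrite (occ_perm _ _ HP) in Hk.
        pose proof (occ_forms r w x y z). unfold dec_at.
        destruct (Nat.eq_dec x w), (fst r); lia.
      * rewrite zsum_dec_at by assumption. lia.
    + destruct (count_occ_extract2 (leaves root u) (false, false) (false, true) x) as [R HR]; [discriminate|unfold occ in *; lia|unfold occ in *; lia|].
      destruct (left_form_exists u R x HR C0 C1 C2) as (y & z & HP).
      rewrite (leaves_determine A op Hop v _ _ HP).
      transitivity (eval op v (right_form x y z)); [|apply Htw].
      apply (IH _ _ (dec_at x k)); auto.
      * apply vars_below_forms. apply (vars_below_perm M _ _ HP Hu).
      * intros r w. specialize (Hk r w). rewrite (occ_perm _ _ HP) in Hk.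
        pose proof (occ_forms r w x y z). unfold dec_at.
        destruct (Nat.eq_dec x w), (fst r); lia.
      * rewrite zsum_dec_at by assumption. lia.
  - apply (leaves_determine A op Hop). apply (Permutation_count_occ tl_dec). intros [r x].
    destruct (Nat.lt_ge_cases x M) as [Hx|Hx].
    + specialize (Hk r x). rewrite (H0 x Hx) in Hk. unfold occ in Hk. destruct (fst r); lia.
    + assert (G : forall w, vars_below M w -> count_occ tl_dec (leaves root w) (r, x) = 0%nat).
      { intros w Hw. apply count_occ_not_In. intros Hin.
        unfold vars_below in Hw. rewrite Forall_forall in Hw.
        specialize (Hw _ Hin). simpl in Hw. lia. }
      rewrite !G; auto.
Qed.

Lemma zsum_abs_nonneg M k : 0 <= zsum M (fun x => Z.abs (k x)).
Proof. induction M; simpl; lia. Qed.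

(** The shift by -1 makes the base case vacuous. If the sum of [k] is negative, [t] and [u] change
    roles. *)
Lemma equal_all A (op : A -> A -> A) (Hop : swapping op) (Htw : twist_law op) v M n :
  equal_upto op v M (Z.of_nat n - 1).
Proof.
  induction n as [|n IH]; intros t u k Ht Hu Hk Hn.
  - pose proof (zsum_abs_nonneg M k). lia.
  - destruct (Z_le_gt_dec 0 (zsum M k)) as [HK|HK].
    + apply (equal_step A op Hop Htw v M _ t u k IH); auto; lia.
    + symmetry. apply (equal_step A op Hop Htw v M _ u t (fun x => - k x) IH); auto.
      * apply differ_by_sym, Hk.
      * rewrite (zsum_ext M _ (fun x => Z.abs (k x))) by (intros; apply Z.abs_opp). lia.
      * rewrite zsum_opp. lia.
Qed.

Lemma vars_below_exists t u : exists M, vars_below M t /\ vars_below M u.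
Proof.
  assert (G : forall L : list (ty * nat), Forall (fun p => (snd p < S (list_max (map snd L)))%nat) L).
  { intros L. apply Forall_forall. intros p Hp.
    pose proof (proj1 (list_max_le (map snd L) _) (le_n _)) as H.
    rewrite Forall_forall in H. specialize (H _ (in_map snd _ _ Hp)). lia. }
  set (L := leaves root t ++ leaves root u).
  exists (S (list_max (map snd L))). apply Forall_app, G.
Qed.

(** * Reading off typed leaves from linear operations on the integers *)

Definition sgn (a b : Z) (r : ty) : Z := (if fst r then a else 1) * (if snd r then b else 1).

(** Each left edge contributes a factor [a], each right edge a factor [b]; as these are signs, only
    the parities matter. *)
Lemma eval_linear a b v t s : a * a = 1 -> b * b = 1 ->
  sgn a b s * eval (fun p q => a * p + b * q) v t =
  fold_right Z.add 0 (map (fun p => sgn a b (fst p) * v (snd p)) (leaves s t)).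
Proof.
  intros Ha Hb. revert s; induction t as [x|t IHt u IHu]; intros s; simpl; [ring|].
  rewrite map_app, fold_right_app.
  assert (G : forall l c, fold_right Z.add c l = fold_right Z.add 0 l + c).
  { clear; induction l as [|d l IH]; intros c; simpl; [|rewrite IH]; ring. }
  rewrite G, <- IHt, <- IHu.
  assert (EL : sgn a b (goL s) = sgn a b s * a).
  { destruct s as [[] []]; unfold sgn, goL; cbn [fst snd negb]; ring [Ha]. }
  assert (ER : sgn a b (goR s) = sgn a b s * b).
  { destruct s as [[] []]; unfold sgn, goR; cbn [fst snd negb]; ring [Hb]. }
  rewrite EL, ER. ring.
Qed.

Lemma eval_indicator a b x t : a * a = 1 -> b * b = 1 ->
  eval (fun p q => a * p + b * q) (fun y => if Nat.eq_dec y x then 1 else 0) t =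
  Z.of_nat (occ (false, false) x t) + b * Z.of_nat (occ (false, true) x t) +
  a * Z.of_nat (occ (true, false) x t) + a * b * Z.of_nat (occ (true, true) x t).
Proof.
  intros Ha Hb. pose proof (eval_linear a b (fun y => if Nat.eq_dec y x then 1 else 0) t root Ha Hb) as E.
  transitivity (sgn a b root * eval (fun p q => a * p + b * q) (fun y => if Nat.eq_dec y x then 1 else 0) t).
  { change (sgn a b root) with 1. lia. }
  rewrite E. unfold occ. clear.
  induction (leaves root t) as [|[r y] L IH]; simpl map; simpl fold_right; [simpl; ring|].
  rewrite IH, !occ_cons, !Nat2Z.inj_add.
  repeat match goal with |- context [count_occ ?d L ?p] => generalize (count_occ d L p) end.
  destruct r as [[] []], (Nat.eq_dec y x); intros; unfold sgn;
    cbn -[Z.of_nat Z.add Z.mul]; ring.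
Qed.

Lemma eval_ext A (f g : A -> A -> A) v t : (forall x y, f x y = g x y) -> eval f v t = eval g v t.
Proof. intros H. induction t; simpl; rewrite ?IHt1, ?IHt2; auto. Qed.

(** For each variable the three operations give three linear equations in the four differences of
    occurrences. Their solutions form a line: [k] at L, LR and [-k] at 0, R. *)
Lemma Sigma124_differ_by t u : Sigma124 (t, u) -> exists k, differ_by k t u.
Proof.
  intros (Hadd & Hsub & Hneg).
  exists (fun x => Z.of_nat (occ (true, false) x t) - Z.of_nat (occ (true, false) x u)).
  intros r x.
  set (v := fun y : nat => if Nat.eq_dec y x then 1 else 0).
  specialize (Hadd v); specialize (Hsub v); specialize (Hneg v). cbn [fst snd] in *.
  assert (E : forall op a b w, a * a = 1 -> b * b = 1 -> (forall p q, op p q = a * p + b * q) ->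
    eval op v w = Z.of_nat (occ (false, false) x w) + b * Z.of_nat (occ (false, true) x w) +
      a * Z.of_nat (occ (true, false) x w) + a * b * Z.of_nat (occ (true, true) x w)).
  { intros op a b w Ha Hb H. rewrite (eval_ext Z _ _ v w H). apply eval_indicator; assumption. }
  rewrite !(E Z.add 1 1) in Hadd by (reflexivity || intros; ring).
  rewrite !(E Z.sub 1 (-1)) in Hsub by (reflexivity || intros; ring).
  rewrite !(E (fun a b => - a - b) (-1) (-1)) in Hneg by (reflexivity || intros; ring).
  destruct r as [[] []]; simpl fst; lia.
Qed.

(** * The basis property *)

Lemma B124_laws A (op : A -> A -> A) :
  (forall e, In e B124 -> satisfies A op e) <-> swapping op /\ twist_law op.
Proof.
  split.
  - intros H.
    pose (v := fun (x y z t : A) n => match n with 0 => x | 1 => y | 2 => z | _ => t end%nat).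
    assert (G : forall i x y z t, (i < 7)%nat ->
      eval op (v x y z t) (fst (nth i B124 (vx, vx))) = eval op (v x y z t) (snd (nth i B124 (vx, vx)))).
    { intros i x y z t Hi. apply H, nth_In, Hi. }
    split; [split|].
    + intros x y z t; apply (G 0%nat x y z t); lia.
    + intros x y z t; apply (G 1%nat x y z t); lia.
    + intros x y z t; apply (G 2%nat x y z t); lia.
    + intros x y z t; apply (G 3%nat x y z t); lia.
    + intros x y z t; apply (G 4%nat x y z t); lia.
    + intros x y z t; apply (G 5%nat x y z t); lia.
    + intros x y z; apply (G 6%nat x y z x); lia.
  - intros [[h1 h2 h3 h4 h5 h6] h7] e He v.
    repeat destruct He as [<-|He]; simpl; auto. contradiction.
Qed.

Lemma B124_basis : is_basis (fun e => In e B124) Sigma124.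
Proof.
  intros [t u]; split.
  - intros H. repeat split; apply H, B124_laws; split; try split; unfold twist_law; intros; ring.
  - intros HS A op HA v. apply B124_laws in HA as [Hop Htw]. simpl.
    destruct (Sigma124_differ_by _ _ HS) as [k Hk].
    destruct (vars_below_exists t u) as (M & Ht & Hu).
    apply (equal_all A op Hop Htw v M
      (Z.to_nat (zsum M (fun x => Z.abs (k x)) + 1)) t u k Ht Hu Hk).
    pose proof (zsum_abs_nonneg M k). lia.
Qed.

Local Close Scope Z_scope.

(** * Independence *)

(* Products of at most three generators are kept apart, products of four are recorded by a truth value, and all other products are [Fin false]. *)
Inductive nil4 : Type :=
| Gen (a : nat)
| Gen2 (a b : nat)
| Left3 (a b c : nat)
| Right3 (a b c : nat)
| Fin (w : bool).

(** One field for each bracketing of four generators, in order: [(ab)(cd)], [((ab)c)d], [(a(bc))d],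
    [a((bc)d)], [a(b(cd))]. *)
Record marking := Marking {
  f22 : nat -> nat -> nat -> nat -> bool;
  f31l : nat -> nat -> nat -> nat -> bool;
  f31r : nat -> nat -> nat -> nat -> bool;
  f13l : nat -> nat -> nat -> nat -> bool;
  f13r : nat -> nat -> nat -> nat -> bool }.

Definition nil4_op (m : marking) (p q : nil4) : nil4 :=
  match p, q with
  | Gen a, Gen b => Gen2 a b
  | Gen2 a b, Gen c => Left3 a b c
  | Gen a, Gen2 b c => Right3 a b c
  | Gen2 a b, Gen2 c d => Fin (f22 m a b c d)
  | Left3 a b c, Gen d => Fin (f31l m a b c d)
  | Right3 a b c, Gen d => Fin (f31r m a b c d)
  | Gen a, Left3 b c d => Fin (f13l m a b c d)
  | Gen a, Right3 b c d => Fin (f13r m a b c d)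
  | _, _ => Fin false
  end.

Definition marking_law (m : marking) (i a b c d : nat) : Prop :=
  match i with
  | 0 => f22 m a b c d = f22 m a c b d
  | 1 => f22 m a b c d = f22 m d b c a
  | 2 => f31l m a b c d = f31l m a d c b
  | 3 => f31r m a b c d = f31r m a d c b
  | 4 => f13l m a b c d = f13l m c b a d
  | 5 => f13r m a b c d = f13r m c b a d
  | _ => f13r m a a b c = f31r m a c b a
  end.

(** An argument that is not a generator makes both sides [Fin false]. *)
Lemma nil4_satisfies m i : i < 7 -> (forall a b c d, marking_law m i a b c d) ->
  satisfies nil4 (nil4_op m) (nth i B124 (Var 0, Var 0)).
Proof.
  intros Hi H v. do 7 try destruct i as [|i]; try lia; simpl in *;
    destruct (v 0); try reflexivity; destruct (v 1); try reflexivity;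
    destruct (v 2); try reflexivity; try (destruct (v 3); try reflexivity);
    simpl; f_equal; auto.
Qed.

Lemma nil4_refutes m i a b c d : i < 7 ->
  satisfies nil4 (nil4_op m) (nth i B124 (Var 0, Var 0)) -> marking_law m i a b c d.
Proof.
  intros Hi H.
  specialize (H (fun n => Gen (match n with 0 => a | 1 => b | 2 => c | _ => d end))).
  do 7 try destruct i as [|i]; try lia; simpl in *; congruence.
Qed.

Definition never (a b c d : nat) : bool := false.
Definition first0 (a b c d : nat) : bool := a =? 0.
Definition second1 (a b c d : nat) : bool := b =? 1.
Definition fourth1 (a b c d : nat) : bool := d =? 1.

(** Only the [i]-th law fails, as seen at the generators 0, 1, 2, 3. Cases 3 and 5 mark two
    bracketings, since the last identity links [f31r] with [f13r]. *)
Definition separating (i : nat) : marking :=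
  match i with
  | 0 => Marking second1 never never never never
  | 1 => Marking first0 never never never never
  | 2 => Marking never second1 never never never
  | 3 => Marking never never second1 never fourth1
  | 4 => Marking never never never first0 never
  | 5 => Marking never never first0 never first0
  | _ => Marking never never never never (fun _ _ _ _ => true)
  end.

Lemma B124_independent : independent B124.
Proof.
  intros i Hi H. change (length B124) with 7 in *.
  assert (G : satisfies nil4 (nil4_op (separating i)) (nth i B124 (Var 0, Var 0))).
  { apply H. intros e (j & Hj & Hij & <-). apply nil4_satisfies; [exact Hj|].
    intros a b c d.
    do 7 try destruct i as [|i]; try lia; do 7 try destruct j as [|j]; try lia; reflexivity. }
  apply (nil4_refutes _ _ 0 1 2 3 Hi) in G.
  do 7 try destruct i as [|i]; try lia; discriminate G.
Qed.

Theorem theorem6p1 :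
  is_basis (fun e => In e B124) Sigma124 /\ independent B124.
Proof.
  split; [apply B124_basis|apply B124_independent].
Qed.
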